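(* Let $\beta\ge 1$ be an integer, let $\rho>0$ and $\tau>0$, and let $M\in\mathbb{C}^{n\times n}$ be a Hermitian positive semidefinite $\beta$-banded matrix with all eigenvalues in the interval $[0,4\rho]$. Then for all indices $k\neq t$ in $\{1,\dots,n\}$: (i) if $\rho\tau\ge 1$ and $\sqrt{4\rho\tau}\le |k-t|/\beta\le 2\rho\tau$, then $$|(\exp(-\tau M))_{kt}|\le 10\exp\left(-\frac{(|k-t|/\beta)^2}{5\rho\tau}\right);$$ (ii) if $|k-t|/\beta\ge 2\rho\tau$, then $$|(\exp(-\tau M))_{kt}|\le 10\,\frac{\exp(-\rho\tau)}{\rho\tau}\left(\frac{\mathrm{e}\,\rho\tau}{|k-t|/\beta}\right)^{|k-t|/\beta}.$$
   Context: A matrix $M\in\mathbb{C}^{n\times n}$ is $\beta$-banded if $M_{ij}=0$ whenever $|i-j|>\beta$. *)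

(* Defs.v *)
From HB Require Import structures.
From mathcomp Require Import all_boot all_order all_algebra.
From mathcomp Require Export sesquilinear spectral.
From mathcomp Require Export complex.
From mathcomp Require Import all_classical all_reals all_analysis.

Set Implicit Arguments.
Unset Strict Implicit.
Unset Printing Implicit Defensive.

Import Order.TTheory GRing.Theory Num.Theory.
Import numFieldNormedType.Exports.

Local Open Scope classical_set_scope.
Local Open Scope ring_scope.
Local Open Scope complex_scope.
Local Open Scope sesquilinear_scope.

Definition idist (n : nat) (i j : 'I_n) : nat := `|(i : nat)%:Z - (j : nat)%:Z|%N.

Definition banded (R : realType) (n beta : nat) (M : 'M[R[i]]_n) : Prop :=
  forall i j : 'I_n, (beta < idist i j)%N -> M i j = 0.

(* On R[i], [0 <= z] means that z is real and nonnegative. *)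
Definition hermitian_psd (R : realType) (n : nat) (M : 'M[R[i]]_n) : Prop :=
  M \is hermsymmx /\
  forall x : 'cV[R[i]]_n, 0 <= (x ^t* *m M *m x) ord0 ord0.

Definition mxexp (C : numFieldType) (n : nat) (A : 'M[C]_n) : 'M[C]_n :=
  lim (series (fun k : nat => (k`!%:R)^-1 *: A ^+ k) @ \oo).

(* Main.v *)
(** Put [a = rho * tau] and [X = (2 * rho - M) / rho], a banded Hermitian matrix
with spectrum in [[-2, 2]], so that [exp (- tau M) = exp (- 2 a) exp (a X)].
Writing each eigenvalue of [X] as [w + w^*] with [|w| = 1] gives
[X = W + W^-1] with [W] unitary.  In the symmetrized binomial expansion of
[X ^ N], the sum [W ^ m + W ^ (- m)] has entries bounded by 2 and is a polynomial
of degree [m] in [X], so it has no [(k, t)] entry when [m < d].  A Chernoff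
argument ([1 <= y ^ (m - d)] for the remaining terms, where [y >= 1]) then yields
[|(X ^ N)_kt| <= 2 y ^ (- d) (y + 1 / y) ^ N], and summing over [N],
[|exp (- tau M)_kt| <= 2 y ^ (- d) exp (a (y + 1 / y - 2))].
Part (i) is [y = exp (d / (2 a))] and part (ii) is [y = d / a]. *)
Require Import Defs.
From mathcomp Require Import all_boot all_order all_algebra.
From mathcomp Require Import all_classical all_reals all_analysis.
From mathcomp Require Import zify ring lra.

Import Order.TTheory GRing.Theory Num.Theory.
Import numFieldNormedType.Exports.
Local Open Scope ring_scope.
Local Open Scope sesquilinear_scope.

(** * Functional calculus for unitarily diagonalised matrices *)

Lemma norm_unitarymx_le1 {C : numClosedFieldType} {m n : nat} {U : 'M[C]_(m, n)} i j :
  U \is unitarymx -> `|U i j| <= 1.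
Proof.
move=> /unitarymxP /matrixP /(_ i i); rewrite !mxE eqxx => UU.
have : `|U i j| ^+ 2 <= 1.
  rewrite -[leRHS]UU (bigD1 j) //= !mxE normCK lerDl sumr_ge0 // => l _.
  by rewrite !mxE -normCK exprn_ge0.
by rewrite expr_le1.
Qed.

Section DiagonalCalculus.
Context {C : numClosedFieldType} {n : nat}.

(** The adjoint stands on the left because [spectralmx] stores eigenvectors as rows. For fixed
    unitary [P], the map from [v] to [conj_diag P v] respects sums, products and adjoints, so matrix
    identities reduce to scalar ones. *)
Definition conj_diag (P : 'M[C]_n) (v : 'I_n -> C) : 'M[C]_n :=
  P^t* *m diag_mx (\row_l v l) *m P.

Lemma conj_diagE P v i j :
  conj_diag P v i j = \sum_l (P l i)^* * v l * P l j.
Proof.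
rewrite /conj_diag mul_mx_diag mxE; apply: eq_bigr => l _.
by rewrite !mxE.
Qed.

Lemma eq_conj_diag P v w : v =1 w -> conj_diag P v = conj_diag P w.
Proof. by move=> /funext ->. Qed.

Lemma conj_diagD P v w :
  conj_diag P v + conj_diag P w = conj_diag P (fun l => v l + w l).
Proof.
apply/matrixP => i j; rewrite mxE !conj_diagE -big_split; apply: eq_bigr => l _.
by rewrite mulrDr mulrDl.
Qed.

Lemma conj_diagZ P c v : c *: conj_diag P v = conj_diag P (fun l => c * v l).
Proof.
apply/matrixP => i j; rewrite mxE !conj_diagE mulr_sumr; apply: eq_bigr => l _.
by rewrite !mulrA [c * _]mulrC.
Qed.

Lemma conj_diag_sum P (I : Type) (r : seq I) (v : I -> 'I_n -> C) :
  \sum_(k <- r) conj_diag P (v k) = conj_diag P (fun l => \sum_(k <- r) v k l).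
Proof.
apply/matrixP => i j; rewrite summxE conj_diagE.
under eq_bigr do rewrite conj_diagE.
rewrite exchange_big; apply: eq_bigr => l _.
by rewrite mulr_sumr mulr_suml.
Qed.

Lemma conj_diag_adj P v : (conj_diag P v)^t* = conj_diag P (fun l => (v l)^*).
Proof.
apply/matrixP => i j; rewrite 2!mxE !conj_diagE rmorph_sum; apply: eq_bigr => l _.
by rewrite !rmorphM /= conjCK mulrC [P l j * _]mulrC mulrA.
Qed.

Context {P : 'M[C]_n}.
Hypothesis uP : P \is unitarymx.

Lemma conj_diagM v w :
  conj_diag P v *m conj_diag P w = conj_diag P (fun l => v l * w l).
Proof.
rewrite /conj_diag !mulmxA -[_ *m P *m P^t* ]mulmxA (unitarymxP uP) mulmx1.
rewrite -[_ *m diag_mx _ *m diag_mx _]mulmxA mulmx_diag.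
by congr (_ *m diag_mx _ *m _); apply/rowP => l; rewrite !mxE.
Qed.

Lemma conj_diag1 : conj_diag P (fun=> 1) = 1%:M.
Proof.
rewrite /conj_diag (_ : \row_l 1 = const_mx 1); last by apply/rowP => l; rewrite !mxE.
by rewrite diag_const_mx mulmx1; apply/mulmx1C/unitarymxP.
Qed.

Lemma conj_diagX v m : conj_diag P v ^+ m = conj_diag P (fun l => v l ^+ m).
Proof.
elim: m => [|m IH]; first by rewrite expr0 conj_diag1.
by rewrite exprS IH [_ * _]conj_diagM; apply: eq_conj_diag => l; rewrite exprS.
Qed.

Lemma conj_diag_unitary v :
  (forall l, v l * (v l)^* = 1) -> conj_diag P v \is unitarymx.
Proof.
move=> v1; apply/unitarymxP; rewrite conj_diag_adj conj_diagM -conj_diag1.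
exact: eq_conj_diag.
Qed.

(** A crude bound, sufficient to carry convergence from the eigenvalues to the entries. *)
Lemma norm_conj_diag_le (v : 'I_n -> C) i j :
  `|conj_diag P v i j| <= \sum_l `|v l|.
Proof.
rewrite conj_diagE (le_trans (ler_norm_sum _ _ _)) // ler_sum // => l _.
rewrite !normrM norm_conjC mulrAC ler_piMl // mulr_ile1 ?norm_unitarymx_le1 //.
Qed.

End DiagonalCalculus.

Local Open Scope complex_scope.

(** * Bandwidth under sums and products *)

Lemma idistD {n : nat} (i j l : 'I_n) : (idist i j <= idist i l + idist l j)%N.
Proof. rewrite /idist; lia. Qed.

Section Banded.
Context {R : realType} {n : nat}.
Implicit Types (p q : nat) (A B : 'M[R[i]]_n).

Lemma banded_leq {p q A} : (p <= q)%N -> banded p A -> banded q A.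
Proof. by move=> pq bA i j qij; apply: bA; exact: leq_ltn_trans qij. Qed.

Lemma bandedD {p A B} : banded p A -> banded p B -> banded p (A + B).
Proof. by move=> bA bB i j pij; rewrite mxE bA // bB // addr0. Qed.

Lemma bandedZ {p} c {A} : banded p A -> banded p (c *: A).
Proof. by move=> bA i j pij; rewrite mxE bA // mulr0. Qed.

Lemma banded_scalar c : banded 0 (c%:M : 'M[R[i]]_n).
Proof.
move=> i j; rewrite mxE; case: eqVneq => [->|//].
by rewrite /idist; lia.
Qed.

Lemma bandedM {p q A B} : banded p A -> banded q B -> banded (p + q) (A *m B).
Proof.
move=> bA bB i j pqij; rewrite mxE big1 // => l _.
have [pil|pil] := ltnP p (idist i l); first by rewrite bA // mul0r.
rewrite bB ?mulr0 //; have := idistD i j l; lia.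
Qed.

End Banded.

(** * Power sums of a unitary matrix and its adjoint *)

Lemma power_sum_rec {S : pzRingType} {a b : S} (m : nat) : a * b = 1 -> b * a = 1 ->
  a ^+ m.+2 + b ^+ m.+2 = (a + b) * (a ^+ m.+1 + b ^+ m.+1) - (a ^+ m + b ^+ m).
Proof.
move=> ab ba; rewrite mulrDl !mulrDr -!exprS.
have -> : a * b ^+ m.+1 = b ^+ m by rewrite exprS mulrA ab mul1r.
have -> : b * a ^+ m.+1 = a ^+ m by rewrite exprS mulrA ba mul1r.
by rewrite [a ^+ m + b ^+ m.+2]addrC addrACA [b ^+ m + _]addrC addrK.
Qed.

Section Unitary.
Context {R : realType} {n : nat}.
Implicit Types U W : 'M[R[i]]_n.

Lemma unitarymxX {U} m : U \is unitarymx -> U ^+ m \is unitarymx.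
Proof.
move=> uU; elim: m => [|m IH].
  by apply/unitarymxP; rewrite expr0 trmx1 map_mx1 mulmx1.
by rewrite exprS; exact: mul_unitarymx.
Qed.

Context {beta : nat} {W : 'M[R[i]]_n}.
Hypotheses (uW : W \is unitarymx) (bW : banded beta (W + W^t*)).

Lemma mul_unitary_adj : W * W^t* = 1. Proof. exact/unitarymxP. Qed.
Lemma mul_adj_unitary : W^t* * W = 1. Proof. exact: mulmx1C mul_unitary_adj. Qed.

Lemma comm_unitary_adj : GRing.comm W (W^t* ).
Proof. by rewrite /GRing.comm mul_unitary_adj mul_adj_unitary. Qed.

(* Chebyshev recurrence: the sums [W ^+ m + W^-1 ^+ m] are polynomials of
   degree [m] in [W + W^-1]. *)
Lemma banded_power_sum m : banded (m * beta) (W ^+ m + W^t* ^+ m).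
Proof.
(* The recurrence looks back two degrees, so the induction carries two consecutive ones. *)
suff [] : banded (m * beta) (W ^+ m + W^t* ^+ m) /\
  banded (m.+1 * beta) (W ^+ m.+1 + W^t* ^+ m.+1) by [].
elim: m => [|m [IH0 IH1]]; split => //.
- rewrite !expr0; apply: bandedD; exact: (banded_scalar 1).
- by rewrite mul1n !expr1.
- rewrite (power_sum_rec m mul_unitary_adj mul_adj_unitary) -scaleN1r.
  rewrite [(m.+2 * _)%N]mulSn; apply: bandedD; first exact: bandedM.
  by apply: bandedZ; apply: banded_leq IH0; lia.
Qed.

Lemma sym_power_prodE {p q} : (q <= p)%N ->
  W ^+ p * W^t* ^+ q + W ^+ q * W^t* ^+ p = W ^+ (p - q) + W^t* ^+ (p - q).
Proof.
have inv m : W ^+ m * W^t* ^+ m = 1.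
  by rewrite -exprMn_comm ?mul_unitary_adj ?expr1n //; exact: comm_unitary_adj.
move=> qp; rewrite -{1 2}(subnK qp) [W ^+ (_ + _)]exprD addnC [W^t* ^+ (_ + _)]exprD.
by rewrite -[W ^+ _ * _ * _]mulrA [W ^+ q * (_ * _)]mulrA !inv mul1r mulr1.
Qed.

Context {y d : R} {k t : 'I_n}.
Hypotheses (beta_gt0 : (0 < beta)%N) (y_ge1 : 1 <= y).
Hypothesis d_le : d * beta%:R <= (idist k t)%:R.

(** The right-hand side copies the symmetrized term with [y] and [y^-1] in place of [W] and [W^t*],
    so that the binomial expansions of both sides can be compared term by term. *)
Lemma norm_sym_power_prod_le p q :
  `|(W ^+ p * W^t* ^+ q + W ^+ q * W^t* ^+ p) k t|
    <= (2 * y `^ (- d) * (y ^+ p * y^-1 ^+ q + y ^+ q * y^-1 ^+ p))%:C.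
Proof.
wlog qp : p q / (q <= p)%N.
  by move=> wl; case/orP: (leq_total q p) => /wl //; rewrite addrC [y ^+ p * _ + _]addrC.
have y0 : 0 < y by exact: lt_le_trans y_ge1.
have prod_ge0 i j : 0 <= y ^+ i * y^-1 ^+ j.
  by rewrite mulr_ge0 // exprn_ge0 // ?invr_ge0 ltW.
have yd0 : 0 < y `^ (- d) by rewrite powR_gt0.
rewrite sym_power_prodE //.
have [lt_kt|le_kt] := ltnP ((p - q) * beta) (idist k t).
  by rewrite banded_power_sum // normr0 ler0c mulr_ge0 ?addr_ge0 // mulr_ge0 // ltW.
have d_le_pq : d <= (p - q)%:R.
  rewrite -(ler_pM2r (x := beta%:R)) ?ltr0n //; apply: le_trans d_le _.
  by rewrite -natrM ler_nat.
have uV : W^t* \is unitarymx by rewrite trmxC_unitary.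
apply: (@le_trans _ _ 2%:C).
  rewrite mxE (le_trans (ler_normD _ _)) // -[2]/(1 + 1) rmorphD /=.
  by rewrite lerD // norm_unitarymx_le1 ?unitarymxX.
(* Only the dominant scalar term [y ^+ (p - q)] is kept; times [y ^ (- d)] it is at least 1, since
   [d <= p - q] and [1 <= y]. *)
rewrite lecR exprVn -expfB_cond; last first.
  by rewrite gt_eqF.
rewrite mulrDr ler_wpDr //; first by rewrite mulr_ge0 // mulr_ge0 // ltW.
rewrite -mulrA ler_peMr //.
rewrite -powR_mulrn ?(ltW y0) // -powRD; last by apply/implyP => _; rewrite gt_eqF.
by rewrite -[leLHS](powRr0 y) ler_powR // addrC subr_ge0.
Qed.

Lemma norm_power_entry_le N :
  `|((W + W^t*) ^+ N) k t| <= (2 * y `^ (- d) * (y + y^-1) ^+ N)%:C.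
Proof.
have comm_adj := comm_unitary_adj.
(* Adding the expansion to its reversal symmetrizes each term, at the price of a factor 2. The
   identity serves both the matrices and the scalars. *)
have sumE (S : pzRingType) (a b : S) : GRing.comm a b ->
    (a + b) ^+ N *+ 2 = \sum_(l < N.+1)
      (a ^+ (N - l) * b ^+ l + a ^+ l * b ^+ (N - l)) *+ 'C(N, l).
  move=> cab; rewrite mulr2n {2}[a + b]addrC (exprDn_comm _ cab).
  rewrite (exprDn_comm _ (commr_sym cab)) -big_split /=; apply: eq_bigr => l _.
  have cXX : b ^+ (N - l) * a ^+ l = a ^+ l * b ^+ (N - l).
    exact/commrX/commr_sym/commrX.
  by rewrite cXX mulrnDl.
rewrite -(ler_pM2r (x := 2)) //.
have -> : `|((W + W^t*) ^+ N) k t| * 2 = `|((W + W^t*) ^+ N *+ 2) k t|.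
  by rewrite mulmxnE normrMn mulr_natr.
have -> : (2 * y `^ (- d) * (y + y^-1) ^+ N)%:C * 2 =
    (2 * y `^ (- d) * ((y + y^-1) ^+ N *+ 2))%:C.
  by rewrite mulr_natr -rmorphMn /= mulrnAr.
rewrite (sumE _ _ _ comm_adj) (sumE _ y y^-1 (mulrC _ _)).
rewrite mulr_sumr rmorph_sum summxE (le_trans (ler_norm_sum _ _ _)) //.
apply: ler_sum => l _.
rewrite mulmxnE normrMn mulrnAr rmorphMn lerMn2r; apply/orP; right.
exact: norm_sym_power_prod_le.
Qed.

End Unitary.

(** * Spectral decomposition with real eigenvalues *)

Lemma hermitian_conj_diag {R : realType} {n : nat} {M : 'M[R[i]]_n} {b : R} :
    M \is hermsymmx ->
    (forall a : R[i], eigenvalue M a -> 0 <= a <= b%:C) ->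
  exists (P : 'M[R[i]]_n) (lam : 'I_n -> R),
    [/\ P \is unitarymx, M = conj_diag P (fun l => (lam l)%:C) &
        forall l, 0 <= lam l <= b].
Proof.
move=> hM hspec; pose P := spectralmx M; pose s := spectral_diag M.
have uP : P \is unitarymx := spectral_unitarymx M.
have ME : M = P^t* *m diag_mx s *m P.
  by rewrite -invmx_unitary //; apply/orthomx_spectralP/hermitian_normalmx.
(* The rows of [P] are left eigenvectors, nonzero because they have norm 1; this transfers the
   spectral hypothesis to the diagonal entries. *)
have s_eig l : eigenvalue M (s 0 l).
  apply/eigenvalueP; exists (row l P); last first.
    apply: contraTneq isT => Pl0; have /matrixP/(_ l l) := unitarymxP uP.
    rewrite !mxE eqxx big1 => [/esym/eqP|j _]; first by rewrite oner_eq0.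
    by have /rowP/(_ j) := Pl0; rewrite !mxE => ->; rewrite mul0r.
  rewrite -row_mul {1}ME !mulmxA (unitarymxP uP) mul1mx mul_diag_mx.
  by apply/rowP => j; rewrite !mxE.
have sE l : s 0 l = (complex.Re (s 0 l))%:C.
  have /andP[s0 _] := hspec _ (s_eig l); rewrite RRe_real //; exact: ger0_real.
exists P, (fun l => complex.Re (s 0 l)); split=> // [|l].
  rewrite {1}ME /conj_diag; congr (_ *m diag_mx _ *m _).
  by apply/rowP => l; rewrite mxE -sE.
by have := hspec _ (s_eig l); rewrite sE !lecR.
Qed.

(** * Exponential series of a diagonalised matrix *)

Section Exponential.
Local Open Scope classical_set_scope.

Lemma mxexpP {C : numFieldType} {n : nat} {A L : 'M[C]_n} :
  (forall i j e, 0 < e -> exists N0, forall N, (N0 <= N)%N ->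
    `|L i j - (\sum_(0 <= k < N) (k`!%:R)^-1 *: A ^+ k) i j| < e) ->
  mxexp A = L.
Proof.
move=> AL; apply: cvg_lim => //; apply/cvg_ballP => e e0.
(* Index pairs form one finite type, so the entrywise thresholds merge into a common one. *)
near=> N; split=> // i j; suff /(_ (i, j)) : forall ij : 'I_n * 'I_n,
  ball (L ij.1 ij.2) e ((\sum_(0 <= k < N) (k`!%:R)^-1 *: A ^+ k) ij.1 ij.2) by [].
near: N; apply: filter_forall => -[{}i {}j].
by have [N0 AN0] := AL i j e e0; exists N0 => // N; exact: AN0.
Unshelve. all: by end_near. Qed.

(** The total truncation error over the spectrum is a single real null sequence that dominates the
    error in every entry. *)
Lemma exp_truncation_cvg0 {R : realType} {n : nat} (v : 'I_n -> R) :
  (\sum_l `|expR (v l) - series (exp_coeff (v l)) N|) @[N --> \oo] --> (0 : R).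
Proof.
rewrite -[X in _ --> X](big1_eq (op := +%R) (index_enum 'I_n) xpredT).
apply: cvg_big => [|l _]; first exact: add_continuous.
rewrite -(normr0 R) -(subrr (expR (v l))); apply: cvg_norm.
by apply: cvgB; [exact: cvg_cst | exact: is_cvg_series_exp_coeff].
Qed.

Context {R : realType} {n : nat} {P : 'M[R[i]]_n}.
Hypothesis uP : P \is unitarymx.

Lemma exp_truncationE (v : 'I_n -> R) N :
  \sum_(0 <= k < N) (k`!%:R)^-1 *: conj_diag P (fun l => (v l)%:C) ^+ k =
  conj_diag P (fun l => (series (exp_coeff (v l)) N)%:C).
Proof.
under eq_bigr do rewrite (conj_diagX uP) conj_diagZ.
rewrite conj_diag_sum; apply: eq_conj_diag => l.
rewrite rmorph_sum; apply: eq_bigr => k _.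
by rewrite /exp_coeff /= rmorphM fmorphV rmorph_nat rmorphXn mulrC.
Qed.

Lemma norm_exp_truncation_le (v : 'I_n -> R) N i j :
  `|(conj_diag P (fun l => (expR (v l))%:C)
       - conj_diag P (fun l => (series (exp_coeff (v l)) N)%:C)) i j|
    <= (\sum_l `|expR (v l) - series (exp_coeff (v l)) N|)%:C.
Proof.
rewrite -scaleN1r conj_diagZ conj_diagD.
rewrite (le_trans (norm_conj_diag_le uP _ _ _)) // rmorph_sum ler_sum // => l _.
by rewrite mulN1r -rmorphB normc_def /= expr0n addr0 sqrtr_sqr.
Qed.

Lemma mxexp_conj_diag (v : 'I_n -> R) :
  mxexp (conj_diag P (fun l => (v l)%:C)) = conj_diag P (fun l => (expR (v l))%:C).
Proof.
(* A positive [e] in [R[i]] has zero imaginary part, so the real limit can be applied to its real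
   part. *)
apply: mxexpP => i j e; rewrite ltcE /= => /andP[/eqP Ime Ree0].
have /cvgrPdist_lt/(_ _ Ree0) [N0 _ N0P] := exp_truncation_cvg0 v.
exists N0 => N /N0P /=; rewrite sub0r normrN => lt_e.
rewrite exp_truncationE.
have := norm_exp_truncation_le v N i j; rewrite !mxE => /le_lt_trans; apply.
rewrite ltcE /= Ime eqxx (le_lt_trans (ler_norm _)) //.
Qed.

(** Since the coefficients [a ^+ m / m!] are nonnegative, the bounds on powers sum to
    [b * expR (a * s)] for every truncation, and the bound survives the limit. *)
Lemma norm_conj_diag_exp_le (x : 'I_n -> R) (a b s : R) k t :
    0 <= a -> 0 <= b -> 0 <= s ->
    (forall N, `|(conj_diag P (fun l => (x l)%:C) ^+ N) k t| <= (b * s ^+ N)%:C) ->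
  `|conj_diag P (fun l => (expR (a * x l))%:C) k t| <= (b * expR (a * s))%:C.
Proof.
move=> a0 b0 s0 bound.
set v := fun l => a * x l.
have trunc_le N : `|conj_diag P (fun l => (series (exp_coeff (v l)) N)%:C) k t|
    <= (b * expR (a * s))%:C.
  have -> : conj_diag P (fun l => (series (exp_coeff (v l)) N)%:C) =
      \sum_(0 <= m < N) (exp_coeff a m)%:C *: conj_diag P (fun l => (x l)%:C) ^+ m.
    rewrite -exp_truncationE; apply: eq_bigr => m _.
    rewrite !(conj_diagX uP) !conj_diagZ; apply: eq_conj_diag => l.
    rewrite /exp_coeff /= /v !rmorphM fmorphV rmorph_nat !rmorphXn exprMn mulrA.
    by rewrite [_^-1 * _]mulrC.
  rewrite summxE (le_trans (ler_norm_sum _ _ _)) //.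
  apply: (@le_trans _ _ (b * series (exp_coeff (a * s)) N)%:C); last first.
    rewrite lecR ler_wpM2l // nondecreasing_cvgn_le //.
      by apply: nondecreasing_series => m _ _; rewrite exp_coeff_ge0 ?mulr_ge0.
    exact: is_cvg_series_exp_coeff.
  rewrite /series /= mulr_sumr rmorph_sum ler_sum // => m _.
  have cm0 := exp_coeff_ge0 m a0.
  rewrite mxE normrM ger0_norm ?ler0c // (le_trans (ler_wpM2l _ (bound m))) ?ler0c //.
  by rewrite -rmorphM lecR /exp_coeff /= exprMn mulrCA
    [a ^+ m * s ^+ m]mulrC mulrAC mulrC -mulrA mulrCA.
have step N : `|conj_diag P (fun l => (expR (v l))%:C) k t|
    <= (b * expR (a * s) + \sum_l `|expR (v l) - series (exp_coeff (v l)) N|)%:C.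
  rewrite -[X in `|X|](subrK
    (conj_diag P (fun l => (series (exp_coeff (v l)) N)%:C) k t)).
  rewrite (le_trans (ler_normD _ _)) // rmorphD addrC lerD //.
  by have := norm_exp_truncation_le v N k t; rewrite !mxE.
move: step; rewrite normc_def lecR => step; apply/ler_addgt0Pr => e e0.
have /cvgrPdist_lt/(_ _ e0) [N0 _ /(_ N0 (leqnn _)) /=] := exp_truncation_cvg0 v.
rewrite sub0r normrN => /(le_lt_trans (ler_norm _)) /ltW lt_e.
have := step N0; rewrite lecR => /le_trans; apply; exact: lerD.
Qed.

End Exponential.

(** * Entry bound with a free parameter *)

Lemma unit_circle_real_part {R : realType} (x : R) : -2 <= x <= 2 ->
  exists w : R[i], w * (w^*)%R = 1 /\ w + (w^*)%R = x%:C.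
Proof.
(* With [x = 2 cos theta], the witness is [exp (i theta)]; the range of [x] makes the radicand
   nonnegative. *)
move=> /andP[x_ge x_le]; exists (x / 2 +i* Num.sqrt (1 - (x / 2) ^+ 2)); split.
  rewrite -normCK normc_def /= sqr_sqrtr; last by rewrite expr2; nra.
  by rewrite addrC subrK sqrtr1 expr1n.
by rewrite [LHS]addcJ /= -(rmorph_nat (real_complex R) 2) -rmorphM /= mulrC divfK.
Qed.

(** The Chernoff parameter [y] stays free, to be chosen differently in the two regimes. *)
Lemma norm_mxexp_entry_le {R : realType} {n beta : nat} {rho tau : R}
    {M : 'M[R[i]]_n} {k t : 'I_n} {d : R} (y : R) :
    (0 < beta)%N -> 0 < rho -> 0 < tau ->
    M \is hermsymmx -> banded beta M ->
    (forall a : R[i], eigenvalue M a -> 0 <= a <= (4 * rho)%:C) ->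
    d * beta%:R <= (idist k t)%:R -> 1 <= y ->
  `|mxexp ((- tau)%:C *: M) k t|
    <= (2 * y `^ (- d) * expR (rho * tau * (y + y^-1 - 2)))%:C.
Proof.
move=> beta0 rho0 tau0 hM bM hspec d_le y1.
have [P [lam [uP ME lamP]]] := hermitian_conj_diag hM hspec.
pose x l := 2 - lam l / rho.
have xP l : -2 <= x l <= 2.
  have /andP[lam0 lam4] := lamP l.
  have lr0 : 0 <= lam l / rho by rewrite divr_ge0 // ltW.
  have lr4 : lam l / rho <= 4 by rewrite ler_pdivrMr.
  by rewrite /x; apply/andP; split; lra.
(* One point of the unit circle is chosen per eigenvalue. Only [W + W^t*] has to be banded, not
   [W]. *)
have [w wP] := choice (fun l => unit_circle_real_part (x l) (xP l)).
pose W := conj_diag P w.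
have uW : W \is unitarymx by apply: conj_diag_unitary => // l; case: (wP l).
have WE : W + W^t* = conj_diag P (fun l => (x l)%:C).
  by rewrite conj_diag_adj conj_diagD; apply: eq_conj_diag => l; case: (wP l).
have bW : banded beta (W + W^t*).
  have -> : W + W^t* = 2%:M + (- rho^-1)%:C *: M.
    rewrite WE ME -[2%:M]mulmx1 mul_scalar_mx -(conj_diag1 uP) !conj_diagZ conj_diagD.
    apply: eq_conj_diag => l; rewrite mulr1 -rmorphM.
    rewrite -(rmorph_nat (real_complex R) 2) -rmorphD /=.
    by rewrite /x mulNr [rho^-1 * _]mulrC.
  apply: bandedD; first exact: banded_leq (banded_scalar _).
  exact: bandedZ.
have y0 : 0 < y by exact: lt_le_trans y1.
have a0 : 0 <= rho * tau by rewrite mulr_ge0 ?ltW.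
have -> : mxexp ((- tau)%:C *: M) =
    (expR (- (2 * (rho * tau))))%:C *:
      conj_diag P (fun l => (expR (rho * tau * x l))%:C).
  rewrite ME conj_diagZ; under eq_conj_diag do rewrite -rmorphM.
  rewrite (mxexp_conj_diag uP) conj_diagZ; apply: eq_conj_diag => l.
  rewrite -rmorphM -expRD /x; congr (expR _)%:C; field.
  by rewrite gt_eqF.
have bound := norm_conj_diag_exp_le uP x (rho * tau) (2 * y `^ (- d)) (y + y^-1) k t a0.
rewrite mxE normrM ger0_norm ?ler0c ?expR_ge0 //.
apply: (le_trans (ler_wpM2l _ (bound _ _ _))).
- by rewrite ler0c expR_ge0.
- by rewrite mulr_ge0 // powR_ge0.
- by rewrite addr_ge0 ?invr_ge0 // ltW.
- by move=> N; rewrite -WE; exact: (norm_power_entry_le uW bW).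
rewrite -rmorphM lecR mulrCA -expRD.
suff -> : - (2 * (rho * tau)) + rho * tau * (y + y^-1) = 
  rho * tau * (y + y^-1 - 2) by [].
ring.
Qed.

(** * A quadratic bound for the hyperbolic cosine *)

Section ScalarBounds.
Context {R : realType}.
Local Open Scope classical_set_scope.

Lemma fact_ge_expn2 m : (24 * 2 ^ m <= (m + 4)`!)%N.
Proof.
elim: m => [//|m IH]; rewrite addSn factS expnS mulnCA leq_mul //; lia.
Qed.

(** The constant 6/5 is the one needed in part (i): for [d = 2 a u], the exponent
    [- d u + 6/5 a u^2] equals [- d^2 / (5 a)]. *)
Lemma expR_sum_opp_le (u : R) : 0 <= u <= 1 ->
  expR u + expR (- u) <= 2 + 6 / 5 * u ^+ 2.
Proof.
move=> /andP[u0 u1].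
(* The terms of degree 0 to 3 add up to [2 + u ^+ 2], and the later ones are
   dominated by a geometric series of total mass [u ^+ 2 / 5]. *)
have trunc_le m : series (exp_coeff u) (m + 4)%N + series (exp_coeff (- u)) (m + 4)%N
    <= 2 + 6 / 5 * u ^+ 2 - 5^-1 * u ^+ 2 / 2 ^+ m.
  elim: m => [|m IH].
    rewrite /series /exp_coeff /= !big_nat_recr //= !big_nil.
    rewrite -[(0`!)%N]/1%N -[(1`!)%N]/1%N -[(2`!)%N]/2%N -[(3`!)%N]/6%N.
    by rewrite le_eqVlt; apply/orP; left; apply/eqP; field.
  rewrite addSn !seriesSr.
  have pow2_gt0 : 0 < (2 ^+ m : R) by rewrite exprn_gt0.
  (* As [u <= 1], the power of [u] may be lowered to 2. The two new terms add at most
     [u^2 / 12 / 2^m], while the bound grows by [u^2 / 10 / 2^m]. *)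
  have coeff_le v : `|v| = u -> exp_coeff v (m + 4)%N <= u ^+ 2 / 24 / 2 ^+ m.
    move=> vu; rewrite (le_trans (ler_norm _)) // /exp_coeff /= normrM normrX vu.
    rewrite normfV normr_nat -mulrA -invfM; apply: ler_pM.
    - by rewrite exprn_ge0.
    - by rewrite invr_ge0.
    - by apply: ler_wiXn2l => //; lia.
    - rewrite lef_pV2 ?posrE ?mulr_gt0 ?ltr0n ?fact_gt0 //.
      by rewrite -natrX -natrM ler_nat fact_ge_expn2.
  have c1 := coeff_le u (ger0_norm u0).
  have c2 : exp_coeff (- u) (m + 4)%N <= u ^+ 2 / 24 / 2 ^+ m.
    by apply: coeff_le; rewrite normrN ger0_norm.
  have half : 5^-1 * u ^+ 2 / 2 ^+ m.+1 = u ^+ 2 / 10 / 2 ^+ m.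
    by rewrite [2 ^+ m.+1]exprS; field; rewrite gt_eqF.
  have eq5 : 5^-1 * u ^+ 2 / 2 ^+ m = 2 * (u ^+ 2 / 10 / 2 ^+ m).
    by field; rewrite gt_eqF.
  have eq24 : u ^+ 2 / 24 / 2 ^+ m = 5 / 12 * (u ^+ 2 / 10 / 2 ^+ m).
    by field; rewrite gt_eqF.
  have q_ge0 : 0 <= u ^+ 2 / 10 / 2 ^+ m.
    by rewrite divr_ge0 ?divr_ge0 ?exprn_ge0 // ltW.
  rewrite half; rewrite eq5 in IH; rewrite eq24 in c1 c2.
  move: (u ^+ 2 / 10 / 2 ^+ m) q_ge0 IH c1 c2 => q; lra.
have cvg_trunc : (series (exp_coeff u) (m + 4)%N + series (exp_coeff (- u)) (m + 4)%N)
    @[m --> \oo] --> expR u + expR (- u).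
  by apply: cvgD; rewrite cvg_shiftn; exact: is_cvg_series_exp_coeff.
rewrite -(cvg_lim _ cvg_trunc) //; apply: limr_le.
  by apply/cvg_ex; exists (expR u + expR (- u)).
near=> m; rewrite (le_trans (trunc_le m)) // gerBl.
by rewrite mulr_ge0 ?invr_ge0 ?exprn_ge0 // mulr_ge0 // exprn_ge0.
Unshelve. all: by end_near. Qed.

End ScalarBounds.

(** * Choice of the parameter in the two decay regimes *)

Theorem theorem4p2 (R : realType) (n beta : nat) (rho tau : R)
  (M : 'M[R[i]]_n)
  (hbeta : (1 <= beta)%N) (hrho : 0 < rho) (htau : 0 < tau)
  (hM : hermitian_psd M) (hband : banded beta M)
  (hspec : forall a : R[i], eigenvalue M a -> 0 <= a <= (4 * rho)%:C)
  (k t : 'I_n) (hkt : k != t) :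
  let d : R := (idist k t)%:R / beta%:R in
  (1 <= rho * tau ->
   Num.sqrt (4 * rho * tau) <= d -> d <= 2 * rho * tau ->
   `| mxexp ((- tau)%:C *: M) k t |
     <= (10 * expR (- (d ^+ 2 / (5 * rho * tau))))%:C)
  /\
  (2 * rho * tau <= d ->
   `| mxexp ((- tau)%:C *: M) k t |
     <= (10 * (expR (- (rho * tau)) / (rho * tau))
         * powR (expR 1 * (rho * tau) / d) d)%:C).
Proof.
move=> d; have beta0 : 0 < beta%:R :> R by rewrite ltr0n.
have d_le : d * beta%:R <= (idist k t)%:R by rewrite /d divfK ?gt_eqF.
have d0 : 0 < d.
  rewrite divr_gt0 // ltr0n /idist; move: hkt; rewrite -val_eqE /=; lia.
clearbody d; have bound y := norm_mxexp_entry_le y hbeta hrho htau hM.1 hband hspec d_le.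
rewrite -[5 * rho * tau]mulrA -[2 * rho * tau]mulrA; set a := rho * tau in bound *.
have a0 : 0 < a by rewrite mulr_gt0.
split=> [_ _ d_le2a|d_ge2a].
(* For [y = exp u] the exponent is about [- d u + a u^2], which is minimal at this [u]; [d <= 2 a]
   gives [u <= 1]. *)
- pose u := d / (2 * a).
  have u0 : 0 <= u by rewrite divr_ge0 ?mulr_ge0 // ltW.
  have u1 : u <= 1 by rewrite ler_pdivrMr ?mul1r // mulr_gt0.
  have dE : d = 2 * a * u by rewrite /u mulrC divfK // mulf_neq0 ?gt_eqF.
  apply: le_trans (bound (expR u) _) _; first by have := expR_ge1Dx u; lra.
  rewrite lecR -expRM -mulrA -expRD ler_pM ?expR_ge0 //; first by lra.
  rewrite ler_expR -expRN.
  have -> : d ^+ 2 / (5 * a) = 4 / 5 * a * u ^+ 2.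
    by rewrite dE; field; rewrite gt_eqF.
  have := expR_sum_opp_le u; rewrite u0 u1 => /(_ isT).
  rewrite dE; nra.
(* The choice [y = d / a] minimises [y ^ (- d) * exp (a y)], the bound with the small term [1 / y]
   neglected. *)
- have y2 : 2 <= d / a by rewrite ler_pdivlMr.
  apply: le_trans (bound (d / a) _) _; first by lra.
  rewrite lecR.
  have d_pow : (expR 1 * a / d) `^ d = expR d * (d / a) `^ (- d).
    have -> : expR 1 * a / d = expR 1 * (d / a) `^ (-1).
      by rewrite powR_inv1 ?invf_div ?mulrA // ltW // divr_gt0.
    by rewrite powRM ?powR_ge0 ?expR_ge0 // -expRM mul1r -powRrM mulN1r.
  (* From [y >= 2], the exponent [d + a / y - 2 a] is at most [d - a - a / 2]; the spare factor
     [exp (- a / 2)] then pays for the denominator [a] of the claim. *)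
  have inv_y : a * (d / a)^-1 <= a / 2.
    by rewrite ler_wpM2l ?(ltW a0) // lef_pV2 // posrE // divr_gt0.
  have exp_le : expR (a * (d / a + (d / a)^-1 - 2)) <= expR d * expR (- a) / expR (a / 2).
    rewrite -expRN -!expRD ler_expR.
    have -> : a * (d / a + (d / a)^-1 - 2) = d + a * (d / a)^-1 - 2 * a.
      by field; rewrite !gt_eqF.
    by move: inv_y; set z := a * _; lra.
  have poly_exp : 2 / expR (a / 2) <= 10 / a.
    rewrite ler_pdivrMr ?expR_gt0 // mulrAC ler_pdivlMr //.
    have := expR_ge1Dx (a / 2); lra.
  rewrite d_pow [leRHS]mulrA [leLHS]mulrAC ler_wpM2r ?powR_ge0 //.
  apply: (@le_trans _ _ (2 / expR (a / 2) * (expR d * expR (- a)))).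
    by rewrite -mulrA ler_wpM2l // [leRHS]mulrC.
  have -> : 10 * (expR (- a) / a) * expR d = 10 / a * (expR d * expR (- a)).
    by field; rewrite gt_eqF.
  by rewrite ler_wpM2r // mulr_ge0 ?expR_ge0.
Qed.
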